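(* There exist a zero-dimensional compact metric space $(X,d)$ and a closed subspace $A\subset X$ such that there is no extension operator for Lipschitz pseudometrics from $A$ to $X$; that is, there is no map $u\colon \mathcal{PM}_{\mathrm{Lip}}(A)\to\mathcal{PM}_{\mathrm{Lip}}(X)$ satisfying all of the following: (1) $u(\varrho_1+\varrho_2)=u(\varrho_1)+u(\varrho_2)$ and $u(\lambda\varrho)=\lambda u(\varrho)$ for all $\varrho_1,\varrho_2,\varrho\in\mathcal{PM}_{\mathrm{Lip}}(A)$ and $\lambda\in\mathbb{R}_+$; (2) $u(\varrho)|_{A\times A}=\varrho$ for every $\varrho\in\mathcal{PM}_{\mathrm{Lip}}(A)$; (3) $\|u\|=\sup\{\|u(\varrho)\|_X \mid \varrho\in\mathcal{PM}_{\mathrm{Lip}}(A),\ \|\varrho\|_A\le 1\}$ is finite.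
   Context: Let $(X,d)$ be a compact metric space and $A\subset X$. A pseudometric $\varrho$ on $A$ is called Lipschitz if there is $C>0$ such that $\varrho(x,y)\le C\,d(x,y)$ for all $x,y\in A$. The set of all Lipschitz pseudometrics on $A$ is denoted $\mathcal{PM}_{\mathrm{Lip}}(A)$; it is a cone under pointwise addition and multiplication by nonnegative scalars. For $\varrho\in\mathcal{PM}_{\mathrm{Lip}}(A)$ put $\|\varrho\|_A=\sup\{\varrho(x,y)/d(x,y)\mid x,y\in A,\ x\neq y\}$ (and similarly $\|\cdot\|_X$ with $A=X$). $\mathbb{R}_+=[0,\infty)$. Zero-dimensional means having a base of clopen sets. *)

(* Defs.v *)
From HB Require Import structures.
From mathcomp Require Export all_boot all_order all_algebra.
From mathcomp Require Export all_classical all_reals all_analysis.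

Set Implicit Arguments.
Unset Strict Implicit.
Unset Printing Implicit Defensive.

Import Order.TTheory GRing.Theory Num.Theory.
Import numFieldNormedType.Exports.

Local Open Scope classical_set_scope.
Local Open Scope ring_scope.

(* A subset [A] of a metric space, seen as the type [set_type A], carries the
   restricted distance; the library only makes it a pseudoMetricType. *)
Section set_type_metric.
Context {R : realType} {X : metricType R} (A : set X).

Let dist (x y : A) : R := mdist (\val x) (\val y).

Let dist_ge0 x y : 0 <= dist x y. Proof. exact: mdist_ge0. Qed.

Let dist_positivity x y : dist x y = 0 -> x = y.
Proof. by move=> /mdist_positivity; exact: val_inj. Qed.

Let ballEdist (x : A) (e : R) : ball x e = [set y | dist x y < e].
Proof.
by rewrite /ball/= /initial_ball /dist; apply/seteqP; split=> y /=;
  rewrite ballEmdist.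
Qed.

HB.instance Definition _ := PseudoMetric_isMetric.Build R (set_type A)
  dist_ge0 dist_positivity ballEdist.

End set_type_metric.

Lemma mdist_set_typeE (R : realType) (X : metricType R) (A : set X)
  (x y : A) : mdist x y = mdist (\val x) (\val y) :> R.
Proof. by []. Qed.

(* The library's [zero_dimensional] is separation of points by clopen sets. *)
Definition has_clopen_base (X : topologicalType) : Prop :=
  exists2 B : set (set X), basis B & B `<=` clopen.

Definition is_pseudometric (R : realType) (T : Type) (rho : T -> T -> R) : Prop :=
  [/\ forall x y, 0 <= rho x y,
      forall x, rho x x = 0,
      forall x y, rho x y = rho y x &
      forall x y z, rho x z <= rho x y + rho y z].

Definition is_lip (R : realType) (T : metricType R) (rho : T -> T -> R) : Prop :=
  exists2 C : R, 0 < C & forall x y, rho x y <= C * mdist x y.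

Record PMLip (R : realType) (T : metricType R) := MkPMLip {
  pmlip_fun :> T -> T -> R ;
  pmlip_pseudometric : is_pseudometric pmlip_fun ;
  pmlip_lip : is_lip pmlip_fun }.

Section cone.
Context {R : realType} {T : metricType R}.
Implicit Types rho : PMLip T.

Lemma pmlip_ext rho1 rho2 : (forall x y, rho1 x y = rho2 x y) -> rho1 = rho2.
Proof.
case: rho1 rho2 => [f1 p1 l1] [f2 p2 l2] /= f12.
have {}f12 : f1 = f2 by apply/funext => x; apply/funext => y.
by subst f2; congr MkPMLip; exact: Prop_irrelevance.
Qed.

Lemma pmlip_add_pseudometric rho1 rho2 :
  is_pseudometric (fun x y => rho1 x y + rho2 x y).
Proof.
have [p0 pxx pC pD] := pmlip_pseudometric rho1.
have [q0 qxx qC qD] := pmlip_pseudometric rho2.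
split=> [x y|x|x y|x y z].
- by rewrite addr_ge0.
- by rewrite pxx qxx addr0.
- by rewrite pC qC.
- by rewrite addrACA lerD.
Qed.

Lemma pmlip_add_lip rho1 rho2 : is_lip (fun x y => rho1 x y + rho2 x y).
Proof.
have [C C0 pC] := pmlip_lip rho1; have [D D0 qD] := pmlip_lip rho2.
by exists (C + D) => [|x y]; rewrite ?addr_gt0// mulrDl lerD.
Qed.

Definition pmlip_add rho1 rho2 : PMLip T :=
  MkPMLip (pmlip_add_pseudometric rho1 rho2) (pmlip_add_lip rho1 rho2).

Lemma pmlip_scale_pseudometric (l : R) (l0 : 0 <= l) rho :
  is_pseudometric (fun x y => l * rho x y).
Proof.
have [p0 pxx pC pD] := pmlip_pseudometric rho.
split=> [x y|x|x y|x y z].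
- by rewrite mulr_ge0.
- by rewrite pxx mulr0.
- by rewrite pC.
- by rewrite -mulrDr ler_wpM2l.
Qed.

Lemma pmlip_scale_lip (l : R) (l0 : 0 <= l) rho :
  is_lip (fun x y => l * rho x y).
Proof.
have [C C0 pC] := pmlip_lip rho; exists (l * C + 1) => [|x y].
  by rewrite ltr_wpDl// mulr_ge0// ltW.
rewrite mulrDl mul1r -mulrA.
by rewrite (le_trans (ler_wpM2l l0 (pC x y)))// lerDl mdist_ge0.
Qed.

Definition pmlip_scale (l : R) (l0 : 0 <= l) rho : PMLip T :=
  MkPMLip (pmlip_scale_pseudometric l0 rho) (pmlip_scale_lip l0 rho).

(* The set is bounded above as [rho] is Lipschitz, so [sup] is its least upper
   bound; when [T] has at most one point it is empty and [sup set0 = 0]. *)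
Definition lip_norm rho : R :=
  sup [set r | exists x y : T, x <> y /\ r = rho x y / mdist x y].

End cone.

Section extension_operator.
Context {R : realType} {X : metricType R} {A : set X}.

Definition ext_op_norm (u : PMLip A -> PMLip X) : \bar R :=
  ereal_sup [set (lip_norm (u rho))%:E | rho in [set rho | lip_norm rho <= 1]].

Definition is_lip_extension_operator (u : PMLip A -> PMLip X) : Prop :=
  [/\ forall rho1 rho2, u (pmlip_add rho1 rho2) = pmlip_add (u rho1) (u rho2),
      forall (l : R) (l0 : 0 <= l) rho,
        u (pmlip_scale l0 rho) = pmlip_scale l0 (u rho),
      forall rho (x y : A), u rho (\val x) (\val y) = rho x y &
      ext_op_norm u \is a fin_num].

End extension_operator.

(* Main.v *)
From HB Require Import structures.
Require Import Defs.
From mathcomp Require Import zify ring lra.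

(** An extension operator for pseudometrics yields a bounded linear extension
    operator for Lipschitz functions: if a point [o] of [A] is far from the piece
    [A_n] of [A], a Lipschitz function [f >= 0] on [A_n] is encoded by the
    pseudometric that adds [f x] to the distance from [x] to [o]; the value of
    the extended pseudometric at [(o, x)] then extends [f], additively in [f].

    So it is enough to glue, along a sequence shrinking to a point, finite pairs
    [(X_n, A_n)] for which linear extension of Lipschitz functions has constants
    tending to infinity. Take for [X_n] a large box in the lattice [Z^I] with the
    l1 metric, and for [A_n] its intersection with the range [E] of a projection
    [p] of [R^I]. Extending the coordinate functions of [E] linearly to the box
    and averaging the result first along [E] and then along the unit vectors
    gives nearly linear maps, whose linear part [T] fixes [E] and maps into [E];
    hence its trace is [dim E]. If the coordinates are [1 / theta]-Lipschitz on
    [E] for the l1 norm and the extension constant is [K], each diagonal entry of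
    [T] is at most [K / theta], so that [K >= theta * dim E / #|I|].
    For the functions of sum zero on three points, [theta = dim E = 2]; the ratio
    [theta * dim E / #|I|] is multiplicative for tensor products, so the [k]-th
    tensor power gives [(4 / 3)^k]. *)

Set Implicit Arguments.
Unset Strict Implicit.
Unset Printing Implicit Defensive.

Import Order.TTheory GRing.Theory Num.Theory.
Import numFieldNormedType.Exports.

Local Open Scope classical_set_scope.
Local Open Scope ring_scope.

(** * Projections with flat range *)

Section spread_projections.

Definition fixed_by (I : finType) (q : I -> I -> int) (w : nat) (a : I -> int) :=
  forall s, \sum_t q s t * a t = w%:Z * a s.

(* [q / w] is the projection, of rank [tau]. *)
Definition spread_proj (I : finType) (q : I -> I -> int) (w tau theta : nat) :=
  [/\ (0 < w)%N,
      forall r, fixed_by q w (q^~ r),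
      \sum_s q s s = (w * tau)%:Z &
      forall a, fixed_by q w a ->
        forall s, theta%:Z * `|a s| <= \sum_t `|a t|].

(** A function fixed by the product is fixed by [p] in the first variable and by [q] in the second,
    so the inequality for [theta] applies along the first variable and then the one for [theta']
    along the second. *)
Lemma spread_proj_tensor (I J : finType) (p : I -> I -> int) (q : J -> J -> int)
    (v w tau tau' theta theta' : nat) :
  spread_proj p v tau theta -> spread_proj q w tau' theta' ->
  spread_proj (fun s t : I * J => p s.1 t.1 * q s.2 t.2)
    (v * w) (tau * tau') (theta * theta').
Proof.
move=> [v0 pp ptr pE] [w0 qq qtr qE].
have sum_prod (F : I -> J -> int) : \sum_x F x.1 x.2 = \sum_i \sum_j F i j.
  by rewrite pair_bigA.
split.
- by rewrite muln_gt0 v0.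
- move=> [r1 r2] [s1 s2] /=.
  rewrite (sum_prod (fun i j => p s1 i * q s2 j * (p i r1 * q j r2))).
  under eq_bigr => i _.
    under eq_bigr => j _ do rewrite mulrACA.
    rewrite -mulr_sumr qq.
    over.
  by rewrite -mulr_suml pp PoszM mulrACA.
- rewrite (sum_prod (fun i j => p i i * q j j)).
  under eq_bigr => i _ do rewrite -mulr_sumr qtr.
  by rewrite -mulr_suml ptr !PoszM mulrACA.
- move=> a aE.
  have aE1 j : fixed_by p v (fun i => a (i, j)).
    (* Up to the factor [v * w], [a] is its own image under the product, which reduces the claim to
       [pp]. *)
    move=> i; apply: (@mulfI _ (v * w)%:Z); first by rewrite -lt0n muln_gt0 v0.
    rewrite mulrCA -(aE (i, j)) mulr_sumr.
    under eq_bigr => i' _ do rewrite mulrCA -(aE (i', j)) mulr_sumr.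
    rewrite exchange_big /= [RHS]mulr_sumr; apply: eq_bigr => -[k l] _ /=.
    under eq_bigr => i' _ do rewrite !mulrA.
    by rewrite -!mulr_suml pp !mulrA.
  have aE2 i : fixed_by q w (fun j => a (i, j)).
    move=> j; apply: (@mulfI _ (v * w)%:Z); first by rewrite -lt0n muln_gt0 v0.
    rewrite mulrCA -(aE (i, j)) mulr_sumr.
    under eq_bigr => j' _ do rewrite mulrCA -(aE (i, j')) mulr_sumr.
    rewrite exchange_big /= [RHS]mulr_sumr; apply: eq_bigr => -[k l] _ /=.
    under eq_bigr => j' _ do rewrite (mulrC (p _ _)) !mulrA.
    by rewrite -!mulr_suml qq; ring.
  move=> [i j]; rewrite PoszM -mulrA (mulrCA theta%:Z).
  apply: (@le_trans _ _ (theta'%:Z * \sum_i' `|a (i', j)|)).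
    by rewrite ler_wpM2l// (pE _ (aE1 j)).
  rewrite mulr_sumr (eq_bigr (fun s => `|a (s.1, s.2)|)); last by case.
  rewrite (sum_prod (fun i j => `|a (i, j)|)).
  by apply: ler_sum => i' _; exact: (qE _ (aE2 i')).
Qed.

Lemma spread_proj_unit : spread_proj (fun _ _ : unit => 1) 1 1 1.
Proof.
split=> //.
- by move=> ? ?; rewrite (big_pred1 tt)//; case.
- by rewrite (big_pred1 tt)//; case.
- by move=> a _ []; rewrite (big_pred1 tt) ?mul1r//; case.
Qed.

(** The matrix is three times the projection onto functions of sum zero; for these each absolute
    value is at most the sum of the other two. *)
Lemma spread_proj_three :
  spread_proj (fun s t : 'I_3 => (s == t)%:Z * 3 - 1) 3 2 2.
Proof.
have sum3 (F : 'I_3 -> int) :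
    \sum_t F t = F (inord 0) + F (inord 1) + F (inord 2).
  rewrite !big_ord_recl big_ord0 addr0 addrA.
  by congr (F _ + F _ + F _); apply: val_inj; rewrite /= inordK.
have forall3 (P : 'I_3 -> Prop) :
    P (inord 0) -> P (inord 1) -> P (inord 2) -> forall s, P s.
  move=> P0 P1 P2 [[|[|[|//]]] s3].
  - by suff -> : Ordinal s3 = inord 0 by []; apply: val_inj; rewrite /= inordK.
  - by suff -> : Ordinal s3 = inord 1 by []; apply: val_inj; rewrite /= inordK.
  - by suff -> : Ordinal s3 = inord 2 by []; apply: val_inj; rewrite /= inordK.
have eq3 i j : (i < 3)%N -> (j < 3)%N ->
    ((inord i : 'I_3) == inord j) = (i == j).
  by move=> i3 j3; rewrite -val_eqE /= !inordK.
split=> //.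
- by move=> r s; move: r s; apply: (@forall3); apply: (@forall3); rewrite sum3 !eq3.
- by rewrite sum3 !eqxx.
- move=> a aE; have := aE (inord 0).
  by rewrite !sum3 !eq3//= => ?; apply: (@forall3); lia.
Qed.

Lemma spread_proj_pow (k : nat) :
  exists (I : finType) (q : I -> I -> int) (w : nat),
    #|I| = (3 ^ k)%N /\ spread_proj q w (2 ^ k) (2 ^ k).
Proof.
elim: k => [|k [I [q [w [cI qP]]]]].
  by exists unit, (fun _ _ => 1), 1%N; rewrite card_unit; split=> //;
    exact: spread_proj_unit.
have := spread_proj_tensor spread_proj_three qP; rewrite -expnS => qP'.
by eexists _, _, _; split; last exact: qP'; rewrite card_prod card_ord cI expnS.
Qed.

End spread_projections.

(** * Averaging functions on a lattice *)

Section averaging.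
Context {R : realFieldType} {I : finType}.
Notation pt := {ffun I -> int}.
Implicit Types (x y g : pt) (h : pt -> R) (l : seq (pt * nat)).

(* Unlike [ffunE], these leave the type [int] in a form that [lia] recognizes. *)
Let ptD x y s : (x + y) s = x s + y s :> int. Proof. by rewrite ffunE. Qed.
Let ptN x s : (- x) s = - x s :> int. Proof. by rewrite ffunE. Qed.
Let ptB x y s : (x - y) s = x s - y s :> int. Proof. by rewrite !ffunE. Qed.
Let ptMn x j s : (x *+ j) s = x s *+ j :> int. Proof. by rewrite ffunMnE. Qed.

Definition l1norm x : nat := \sum_s `|x s|%N.

Lemma l1normD x y : (l1norm (x + y)%R <= l1norm x + l1norm y)%N.
Proof.
by rewrite /l1norm -big_split/=; apply: leq_sum => s _; rewrite ptD; lia.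
Qed.

Lemma l1norm0 : l1norm 0 = 0%N.
Proof. by rewrite /l1norm big1// => s _; rewrite ffunE. Qed.

Lemma l1normN x : l1norm (- x) = l1norm x.
Proof. by apply: eq_bigr => s _; rewrite ptN; lia. Qed.

Lemma l1normMn x j : l1norm (x *+ j) = (j * l1norm x)%N.
Proof.
by rewrite /l1norm big_distrr/=; apply: eq_bigr => s _; rewrite ptMn; lia.
Qed.

Definition unit_vec (s : I) : pt := [ffun t => (t == s)%:Z].

Lemma l1norm_unit s : l1norm (unit_vec s) = 1%N.
Proof.
rewrite /l1norm (bigD1 s)//= ffunE eqxx big1 ?addn0// => t /negPf ts.
by rewrite ffunE ts.
Qed.

Definition lipschitz_l1 (k : R) h :=
  forall x y, `|h x - h y| <= k * (l1norm (x - y))%:R.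

Definition avg g (M : nat) h x : R := (\sum_(j < M) h (x + g *+ j)) / M%:R.

Lemma avg_bound g M h x (c e : R) : (0 < M)%N ->
  (forall j, (j < M)%N -> `|h (x + g *+ j) - c| <= e) -> `|avg g M h x - c| <= e.
Proof.
move=> M0 he; rewrite /avg.
have M0' : 0 < M%:R :> R by rewrite ltr0n.
have -> : (\sum_(j < M) h (x + g *+ j)) / M%:R - c =
    (\sum_(j < M) (h (x + g *+ j) - c)) / M%:R.
  rewrite sumrB sumr_const card_ord mulrBl -[c *+ M]mulr_natr mulfK//.
  by rewrite gt_eqF.
rewrite normrM [`|M%:R^-1|]gtr0_norm ?invr_gt0// ler_pdivrMr//.
apply: (le_trans (ler_norm_sum _ _ _)).
rewrite mulr_natr -[in leRHS](card_ord M) -sumr_const.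
by apply: ler_sum => j _; exact: he.
Qed.

Lemma avg_lipschitz g M k h : (0 < M)%N ->
  lipschitz_l1 k h -> lipschitz_l1 k (avg g M h).
Proof.
move=> M0 hk x y.
have -> : avg g M h x - avg g M h y =
    avg g M (fun z => h z - h (z + (y - x))) x - 0.
  rewrite subr0 /avg -mulrBl -sumrB; congr (_ / _); apply: eq_bigr => j _.
  by congr (_ - h _); rewrite [RHS]addrAC subrKC.
apply: avg_bound => // j _; rewrite subr0 (le_trans (hk _ _))//.
by rewrite opprD addNKr opprB.
Qed.

Lemma avg_comm g M g' M' h : avg g M (avg g' M' h) = avg g' M' (avg g M h).
Proof.
apply/funext => x; rewrite /avg -!mulr_suml mulrAC; congr (_ / _ / _).
by rewrite exchange_big; apply: eq_bigr => i _; apply: eq_bigr => j _; rewrite addrAC.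
Qed.

(** The sum telescopes. The factor [M%:R^-1] is what makes averaged Lipschitz functions nearly
    additive. *)
Lemma avg_shift g M h x :
  avg g M h (x + g) - avg g M h x = (h (x + g *+ M) - h x) / M%:R.
Proof.
rewrite /avg -mulrBl -sumrB; congr (_ / _).
under eq_bigr => j _ do rewrite -addrA -mulrS.
rewrite -(big_mkord xpredT (fun j => h (x + g *+ j.+1) - h (x + g *+ j))).
by rewrite telescope_sumr// mulr0n addr0.
Qed.

Definition avgs l h := foldr (fun d => avg d.1 d.2) h l.

(** Averagings commute, so any one of them can be performed last. The index of [P] counts averagings
    and lets the property degrade with each; the one pulled out is counted too, which [Pmono]
    permits. *)
Lemma avgs_pull (P : nat -> (pt -> R) -> Prop) l h d :
  (forall n f, P n f -> P n.+1 f) ->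
  (forall n f e, e \in l -> P n f -> P n.+1 (avg e.1 e.2 f)) ->
  P 0%N h -> d \in l ->
  exists2 f, P (size l) f & avgs l h = avg d.1 d.2 f.
Proof.
move=> Pmono; elim: l d => // e l IH d Pavg P0.
rewrite inE => /predU1P[->|dl].
  exists (avgs l h) => //=; apply: Pmono.
  have {}Pavg n f e' : e' \in l -> P n f -> P n.+1 (avg e'.1 e'.2 f).
    by move=> e'l; apply: (Pavg); rewrite inE e'l orbT.
  elim: {IH}l Pavg => //= e' l IH' Pavg; apply: (Pavg); rewrite ?mem_head//.
  by apply: IH' => n f e'' e''l; apply: (Pavg); rewrite inE e''l orbT.
have [|f Pf hf] := IH d _ P0 dl.
  by move=> n f e' e'l; apply: (Pavg); rewrite inE e'l orbT.
exists (avg e.1 e.2 f) => /=; first by apply: (Pavg); rewrite ?mem_head.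
by rewrite hf avg_comm.
Qed.

Lemma avgs_rel (J : finType) (c : J -> R) (h : J -> pt -> R) l :
  (forall x, \sum_t c t * h t x = 0) ->
  forall x, \sum_t c t * avgs l (h t) x = 0.
Proof.
move=> h0; elim: l => //= -[g M] l IH x; rewrite /avg /=.
under eq_bigr => t _ do rewrite mulrA mulr_sumr.
by rewrite -mulr_suml exchange_big/= big1 ?mul0r.
Qed.

(** Walk from the origin to [v] by unit steps: each changes the deviation [G] from an affine map by
    at most [eta] times the current norm. *)
Lemma near_additive_linear (F : pt -> R) (eta : R) (v : pt) : 0 <= eta ->
  (forall s y, `|F (y + unit_vec s) - F y - (F (unit_vec s) - F 0)|
     <= eta * (l1norm y)%:R) ->
  `|F v - F 0 - \sum_s (v s)%:~R * (F (unit_vec s) - F 0)|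
    <= eta * (l1norm v)%:R ^+ 2.
Proof.
move=> eta0 Fe; pose G x := F x - F 0 - \sum_s (x s)%:~R * (F (unit_vec s) - F 0).
have Ge s y : `|G (y + unit_vec s) - G y| <= eta * (l1norm y)%:R.
  apply: le_trans (Fe s y); rewrite le_eqVlt; apply/orP; left; apply/eqP.
  congr `| _ |; rewrite /G.
  have -> : \sum_t ((y + unit_vec s) t)%:~R * (F (unit_vec t) - F 0) =
      \sum_t (y t)%:~R * (F (unit_vec t) - F 0) + (F (unit_vec s) - F 0).
    under eq_bigr => t _ do rewrite ffunE intrD mulrDl.
    rewrite big_split/=; congr (_ + _).
    rewrite (bigD1 s)//= ffunE eqxx mul1r big1 ?addr0// => t /negPf ts.
    by rewrite ffunE ts mul0r.
  by ring.
rewrite -/(G v); move nE : (l1norm v) => n.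
elim: n v nE => [|n IH] v nE.
  suff -> : v = 0.
    by rewrite /G big1 => [|s _]; rewrite ?ffunE ?mul0r// !subrr normr0 expr0n mulr0.
  apply/ffunP => s; rewrite ffunE; apply/eqP; rewrite -absz_eq0 -leqn0 -nE.
  by rewrite /l1norm (bigD1 s)//= leq_addr.
have [s vs] : exists s, v s != 0.
  apply/existsP; apply: contraPT nE => /existsPn v0.
  by rewrite /l1norm big1// => s _; have := v0 s; rewrite negbK => /eqP ->.
have split_norm x : l1norm x = (`|x s| + \sum_(t | t != s) `|x t|)%N.
  by rewrite /l1norm (bigD1 s).
have eqrest x y : (forall t, t != s -> x t = y t) ->
    (\sum_(t | t != s) `|x t| = \sum_(t | t != s) `|y t|)%N.
  by move=> xy; apply: eq_bigr => t ts; rewrite xy.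
have sq : (n.+1%:R ^+ 2 : R) = n%:R ^+ 2 + 2 * n%:R + 1.
  by rewrite -natr1; ring.
have n0 : 0 <= n%:R :> R by [].
have en0 : 0 <= eta * n%:R by rewrite mulr_ge0.
(* The last step of the walk follows the sign of [v s]; its cost is at most [eta * n.+1%:R], and
   [n ^ 2 + n + 1 <= (n + 1) ^ 2]. *)
have [vs0|vs0] := ltP 0 (v s).
  have vE : v = v - unit_vec s + unit_vec s by rewrite subrK.
  have nv' : l1norm (v - unit_vec s) = n.
    move: nE; rewrite !split_norm (eqrest (v - unit_vec s) v).
      by rewrite ptB ffunE eqxx; lia.
    by move=> t /negPf ts; rewrite !ffunE ts subr0.
  have := Ge s (v - unit_vec s); rewrite subrK nv' => Gv.
  have := IH _ nv'; rewrite sq; set a := G v in Gv *; set b := G _ in Gv * => Gb.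
  have : `|a| <= `|a - b| + `|b| by rewrite -{1}(subrK b a) ler_normD.
  move: Gv Gb en0; rewrite !mulrDr mulr1 mulrA; lra.
have nv' : l1norm (v + unit_vec s) = n.
  move: nE; rewrite !split_norm (eqrest (v + unit_vec s) v).
    by rewrite ptD ffunE eqxx; lia.
  by move=> t /negPf ts; rewrite !ffunE ts addr0.
have := Ge s v; rewrite nE => Gv.
have := IH _ nv'; rewrite sq; set a := G v in Gv *; set b := G _ in Gv * => Gb.
have : `|a| <= `|b - a| + `|b| by rewrite -{1}(subrK b a) distrC ler_normD.
by move: Gv Gb en0; rewrite -natr1 !mulrDr mulr1 mulrA; lra.
Qed.

End averaging.

(** * The trace inequality *)

(** Puts the relation [\sum_t c t * F t = w * F s] into the homogeneous form required by [avgs_rel]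
    and [extends_families]. *)
Lemma sum_subdelta (R : pzRingType) (I : finType) (c : I -> R) (w : R)
    (F : I -> R) (s : I) :
  \sum_t (c t - w * (t == s)%:R) * F t = \sum_t c t * F t - w * F s.
Proof.
under eq_bigr => t _ do rewrite mulrBl.
rewrite sumrB; congr (_ - _).
rewrite (bigD1 s)//= eqxx mulr1 big1 ?addr0// => t /negPf ->.
by rewrite mulr0 mul0r.
Qed.

Section trace_bound.
Context {R : realFieldType} {I : finType} (q : I -> I -> int).
Context (w tau theta : nat) (qP : spread_proj q w tau theta).
Notation pt := {ffun I -> int}.
Implicit Types (x y a : pt) (h : pt -> R).

Let col (t : I) : pt := [ffun s => q s t].

Let fixed_col t : fixed_by q w (col t).
Proof.
by case: qP => _ qq _ _ s; rewrite ffunE -(qq t s); apply: eq_bigr => r _; rewrite ffunE.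
Qed.

Let fixed0 : fixed_by q w (0 : pt).
Proof. by move=> s; rewrite ffunE mulr0 big1// => t _; rewrite ffunE mulr0. Qed.

Let fixedDMn (a b : pt) j :
  fixed_by q w a -> fixed_by q w b -> fixed_by q w (a + b *+ j).
Proof.
move=> aE bE s; rewrite ffunE ffunMnE mulrDr -aE mulrnAr -bE -sumrMnl -big_split.
by apply: eq_bigr => t _; rewrite ffunE ffunMnE mulrDr mulrnAr.
Qed.

(* Up to a constant, [h] is close to the [t]-th coordinate on the part of the
   lattice [E] that remains in reach after [n] averagings of range [C]. *)
Let near_coord (k : R) (M C B : nat) (t : I) (n : nat) h :=
  lipschitz_l1 k h /\
  exists m, forall a, fixed_by q w a -> (l1norm a + n * C <= B)%N ->
    `|h a - (a t)%:~R - m| <= n%:R * (k * M%:R).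

Let near_coordS (k : R) M C B t n h : 0 <= k ->
  near_coord k M C B t n h -> near_coord k M C B t n.+1 h.
Proof.
move=> k0 [hk [m hm]]; split=> //; exists m => a aE aB.
apply: (le_trans (hm a aE _)); first by move: aB; rewrite mulSn; lia.
by rewrite ler_wpM2r ?mulr_ge0// ler_nat.
Qed.

(** Unit vectors may leave [E], so the Lipschitz bound is used: a displacement of at most [M] costs
    [k * M%:R]. *)
Let near_coord_unit (k : R) M C B t n h s : 0 <= k -> (0 < M)%N ->
  near_coord k M C B t n h -> near_coord k M C B t n.+1 (avg (unit_vec s) M h).
Proof.
move=> k0 M0 [hk [m hm]]; split; first exact: avg_lipschitz.
exists m => a aE aB; rewrite -addrA -opprD; apply: avg_bound => // j jM.
have -> : h (a + unit_vec s *+ j) - ((a t)%:~R + m) =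
  (h (a + unit_vec s *+ j) - h a) + (h a - (a t)%:~R - m) by ring.
rewrite (le_trans (ler_normD _ _))// -natr1 mulrDl mul1r addrC lerD//.
  by apply: hm => //; move: aB; rewrite mulSn; lia.
rewrite (le_trans (hk _ _))// ler_wpM2l// ler_nat addrAC subrr add0r.
by rewrite l1normMn l1norm_unit muln1 ltnW.
Qed.

(** Columns lie in [E], so the averaging stays where [h] is controlled; the mean displacement of the
    coordinate is absorbed into [m], and only the reach shrinks, by at most [C]. *)
Let near_coord_col (k : R) M C B t n h r L : 0 <= k -> (0 < L)%N ->
  (L * l1norm (col r) <= C)%N ->
  near_coord k M C B t n h -> near_coord k M C B t n.+1 (avg (col r) L h).
Proof.
move=> k0 L0 LC [hk [m hm]]; split; first exact: avg_lipschitz.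
exists (m + (\sum_(j < L) (col r t)%:~R *+ j) / L%:R) => a aE aB.
have -> : avg (col r) L h a - (a t)%:~R -
    (m + (\sum_(j < L) (col r t)%:~R *+ j) / L%:R) =
    avg (col r) L (fun x => h x - (x t)%:~R) a - m.
  rewrite /avg sumrB mulrBl.
  have -> : \sum_(j < L) ((a + col r *+ j) t)%:~R =
      (a t)%:~R * L%:R + \sum_(j < L) (col r t)%:~R *+ j :> R.
    under eq_bigr => j _ do rewrite ffunE ffunMnE intrD rmorphMn.
    by rewrite big_split/= sumr_const card_ord mulr_natr.
  rewrite mulrDl mulfK; first by ring.
  by rewrite pnatr_eq0 -lt0n.
apply: avg_bound => // j jL.
apply: (le_trans (hm _ _ _)); first exact: fixedDMn.
  rewrite (leq_trans _ aB)// mulSn addnA leq_add2r.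
  rewrite (leq_trans (l1normD _ _))// leq_add2l l1normMn.
  by rewrite (leq_trans _ LC)// leq_mul2r ltnW ?orbT.
by rewrite ler_wpM2r ?mulr_ge0// ler_nat.
Qed.

(** [h] stands for a map into the range of [q] that fixes [E] near the origin. Once averaged, its
    linear part has a trace that is evaluated on the columns of [q] and bounded through the diagonal
    entries. *)
Lemma trace_le_lipschitz : (0 < #|I|)%N ->
  exists B : nat, forall (k : R) (h : I -> pt -> R), 0 <= k ->
    (forall t, lipschitz_l1 k (h t)) ->
    (forall s x, \sum_t (q s t)%:~R * h t x = w%:R * h s x) ->
    (forall t a, fixed_by q w a -> (l1norm a <= B)%N -> h t a = (a t)%:~R) ->
    tau%:R <= 3 * k * #|I|%:R.
Proof.
have [w0 _ qtr _] := qP; set N := #|I| => N0.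
pose V := (\sum_t l1norm (col t))%N.
have colV t : (l1norm (col t) <= V)%N by rewrite /V (bigD1 t)//= leq_addr.
(* [M] makes the total error of non-additivity at most [k] ([errM]); [L], chosen after [M], does the
   same for the drift caused by unit averagings ([errL]). [B] leaves room for [N.*2] averagings and
   one further displacement of length at most [C]. *)
pose M := (2 * N * V ^ 2).+1; pose L := (4 * N ^ 2 * M).+1.
pose C := (L * V)%N; pose B := (N.*2.+1 * C)%N.
exists B => k h k0 hk hrel hE.
pose l := [seq (unit_vec s, M) | s <- enum I] ++ [seq (col t, L) | t <- enum I].
have szl : size l = N.*2 by rewrite size_cat !size_map -enumT -cardT addnn.
have unit_l s : (unit_vec s, M) \in l.
  by rewrite mem_cat map_f// mem_enum.
have col_l t : (col t, L) \in l.
  by rewrite mem_cat orbC map_f// mem_enum.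
have lP e : e \in l ->
    (exists s, e = (unit_vec s, M)) \/ (exists t, e = (col t, L)).
  by rewrite mem_cat => /orP[] /mapP[s _ ->]; [left|right]; exists s.
pose H t := avgs l (h t).
have Hlip t s y :
    `|H t (y + unit_vec s) - H t y - (H t (unit_vec s) - H t 0)|
      <= 2 * k / M%:R * (l1norm y)%:R.
  have [||f fk Hf] := @avgs_pull R I (fun=> lipschitz_l1 k) l (h t) _ _ _ (hk t) (unit_l s).
  - by [].
  - by move=> n f e /lP[[r ->]|[r ->]] fk; apply: avg_lipschitz.
  have f0 := avg_shift (unit_vec s) M f 0; rewrite !add0r in f0.
  rewrite /H Hf /= avg_shift f0 -mulrBl.
  rewrite normrM [`|M%:R^-1|]gtr0_norm ?invr_gt0 ?ltr0n// mulrAC ler_wpM2r//.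
  have -> : f (y + unit_vec s *+ M) - f y - (f (unit_vec s *+ M) - f 0) =
    (f (y + unit_vec s *+ M) - f (unit_vec s *+ M)) - (f y - f 0) by ring.
  rewrite (le_trans (ler_normB _ _))// -mulrA mulrDl mul1r lerD//.
    by rewrite (le_trans (fk _ _))// addrK.
  by rewrite (le_trans (fk _ _))// subr0.
(* With the averaging along [col t] performed last, the increment compares the endpoints [0] and
   [col t *+ L], both in [E]; each is off by at most [N.*2%:R * (k * M%:R)], and the sum is divided
   by [L]. *)
have Hcol t : `|H t (col t) - H t 0 - (q t t)%:~R| <= 4 * N%:R * (k * M%:R) / L%:R.
  have [|||f [fk [m fm]] Hf] := @avgs_pull R I (near_coord k M C B t) l (h t) _ _ _ _ (col_l t).
  - by move=> n f; exact: near_coordS.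
  - move=> n f e /lP[[r ->]|[r ->]]; first exact: near_coord_unit.
    by apply: near_coord_col => //; rewrite leq_mul2l colV orbT.
  - split=> //; exists 0 => a aE; rewrite mul0n addn0 => aB.
    by rewrite hE// subrr subrr normr0 mul0r.
  rewrite szl in fm.
  have f0 := avg_shift (col t) L f 0; rewrite !add0r in f0.
  rewrite /H Hf /= f0.
  have L0 : L%:R != 0 :> R by rewrite pnatr_eq0.
  have -> : (f (col t *+ L) - f 0) / L%:R - (q t t)%:~R =
    ((f (col t *+ L) - ((col t *+ L) t)%:~R - m) -
     (f 0 - ((0 : pt) t)%:~R - m)) / L%:R.
    by rewrite ffunMnE !ffunE rmorphMn/= -mulr_natr; field.
  rewrite normrM [`|L%:R^-1|]gtr0_norm ?invr_gt0 ?ltr0n// ler_wpM2r//.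
  rewrite (le_trans (ler_normB _ _))//.
  have -> : 4 * N%:R * (k * M%:R) =
      N.*2%:R * (k * M%:R) + N.*2%:R * (k * M%:R) :> R.
    by rewrite -muln2 natrM; ring.
  rewrite lerD// fm//.
  - by rewrite -[col t *+ L]add0r; exact: fixedDMn.
  - by rewrite l1normMn /B mulSn leq_add2r leq_mul2l colV orbT.
  - by rewrite l1norm0 add0n /B leq_mul2r leqnSn orbT.
(* The matrix of the linear part: the [t]-th component of the image of the [s]-th unit vector. *)
pose D s t := H t (unit_vec s) - H t 0.
have Dcol t : `|H t (col t) - H t 0 - \sum_s (q s t)%:~R * D s t|
    <= 2 * k / M%:R * V%:R ^+ 2.
  have eta0 : 0 <= 2 * k / M%:R by rewrite !mulr_ge0.
  have := @near_additive_linear R I (H t) _ (col t) eta0 (Hlip t).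
  rewrite (eq_bigr (fun s => (q s t)%:~R * D s t)) => [/le_trans|s _]; last first.
    by rewrite ffunE.
  apply; rewrite ler_wpM2l// lerXn2r// ?nnegrE// ler_nat.
  exact: colV.
have Hrel s x : \sum_t (q s t)%:~R * H t x = w%:R * H s x.
  apply/eqP; rewrite -subr_eq0 -(sum_subdelta _ _ (H^~ x)); apply/eqP.
  apply: avgs_rel => y; rewrite (sum_subdelta _ _ (h^~ y)).
  by rewrite hrel subrr.
have Hk s : D s s <= k.
  have [||f fk Hf] := @avgs_pull R I (fun=> lipschitz_l1 k) l (h s) _ _ _ (hk s) (unit_l s).
  - by [].
  - by move=> n f e /lP[[r ->]|[r ->]] fk; apply: avg_lipschitz.
  rewrite /D /H Hf (le_trans (ler_norm _))//.
  by rewrite (le_trans (avg_lipschitz _ _ fk _ _))// subr0 l1norm_unit mulr1.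
(* Summing over [t] first, [Hrel] collapses the double sum to [w] times the trace of [D]. *)
have sumD : \sum_t \sum_s (q s t)%:~R * D s t <= w%:R * (N%:R * k).
  rewrite exchange_big /=.
  under eq_bigr => s _.
    under eq_bigr => t _ do rewrite mulrBr.
    rewrite sumrB !Hrel -mulrBr.
    over.
  rewrite -mulr_sumr ler_wpM2l// mulr_natl -[k *+ N]sumr_const.
  by apply: ler_sum => s _; exact: Hk.
have trE : w%:R * tau%:R = \sum_t (q t t)%:~R :> R.
  by rewrite -(rmorph_sum (intr : int -> R)) /= qtr -natrM pmulrn.
have M0 : 0 < M%:R :> R by rewrite ltr0n.
have L0 : 0 < L%:R :> R by rewrite ltr0n.
have bound t : (q t t)%:~R <= \sum_s (q s t)%:~R * D s t +
    (4 * N%:R * (k * M%:R) / L%:R + 2 * k / M%:R * V%:R ^+ 2).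
  by have := Hcol t; have := Dcol t; rewrite !ler_norml; lra.
have errM : N%:R * (2 * k / M%:R * V%:R ^+ 2) <= k.
  have -> : N%:R * (2 * k / M%:R * V%:R ^+ 2) =
    k * ((2 * N * V ^ 2)%:R / M%:R) by rewrite !natrM; ring.
  by rewrite ler_piMr// ler_pdivrMr// mul1r ler_nat.
have errL : N%:R * (4 * N%:R * (k * M%:R) / L%:R) <= k.
  have -> : N%:R * (4 * N%:R * (k * M%:R) / L%:R) =
    k * ((4 * N ^ 2 * M)%:R / L%:R) by rewrite !natrM; ring.
  by rewrite ler_piMr// ler_pdivrMr// mul1r ler_nat.
have : w%:R * tau%:R <= w%:R * (N%:R * k) + (k + k).
  rewrite trE (le_trans (ler_sum _ (fun t _ => bound t)))// big_split/=.
  by rewrite lerD// sumr_const -[leLHS]mulr_natl mulrDr lerD.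
have w1 : 1 <= w%:R :> R by rewrite ler1n.
have N1 : 1 <= N%:R :> R by rewrite ler1n.
(* The errors [k + k] are absorbed here, whence the constant 3. *)
have wNk : k <= w%:R * (N%:R * k).
  by rewrite mulrA ler_peMl// -[leLHS]mulr1 ler_pM.
move=> wtau; rewrite -(ler_pM2l (lt_le_trans ltr01 w1)).
rewrite (le_trans wtau)// -mulrA (mulrC k) mulrCA; lra.
Qed.

End trace_bound.

(** * Gluing finite metric spaces *)

Record finite_metric (R : realType) := FiniteMetric {
  fm_pt :> finType ;
  fm_dist : fm_pt -> fm_pt -> R ;
  fm_distxx : forall x, fm_dist x x = 0 ;
  fm_dist_sep : exists2 e : R, 0 < e & forall x y, x != y -> e <= fm_dist x y ;
  fm_dist_sym : forall x y, fm_dist x y = fm_dist y x ;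
  fm_dist_triangle : forall y x z, fm_dist x z <= fm_dist x y + fm_dist y z ;
  fm_dist_le1 : forall x y, fm_dist x y <= 1 }.

(* [None] is the limit point to which the pieces [P n], rescaled to diameter at
   most [(n + 1)^-1], converge. *)
Definition wedge (R : realType) (P : nat -> finite_metric R) :=
  option {n : nat & P n}.

HB.instance Definition _ (R : realType) (P : nat -> finite_metric R) :=
  Choice.on (wedge P).

Section wedge.
Context {R : realType} (P : nat -> finite_metric R).

Definition radius (n : nat) : R := n.+1%:R^-1.

Lemma radius_gt0 n : 0 < radius n. Proof. by rewrite invr_gt0. Qed.

Let radius_ge0 n : 0 <= radius n. Proof. exact/ltW/radius_gt0. Qed.

Definition piece n (x : P n) : wedge P := Some (Tagged (fun n => P n : Type) x).

(** All points of a piece are equidistant from any given point outside it; [bump_pseudometric]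
    relies on this. *)
Definition wedge_dist (x y : wedge P) : R :=
  match x, y with
  | None, None => 0
  | None, Some p | Some p, None => radius (tag p)
  | Some p, Some p' =>
    if tag p == tag p' then radius (tag p) * fm_dist (tagged p) (tagged_as p p')
    else radius (tag p) + radius (tag p')
  end.

Lemma wedge_dist_piece n (x y : P n) :
  wedge_dist (piece x) (piece y) = radius n * fm_dist x y.
Proof. by rewrite /= eqxx tagged_asE. Qed.

Lemma wedge_dist_pieces n m (x : P n) (y : P m) : n != m ->
  wedge_dist (piece x) (piece y) = radius n + radius m.
Proof. by rewrite /= => /negPf ->. Qed.

Lemma wedge_ind (Q : wedge P -> Prop) :
  Q None -> (forall n (x : P n), Q (piece x)) -> forall x, Q x.
Proof. by move=> Q0 Q1 [[n x]|//]; exact: Q1. Qed.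

Lemma fm_dist_ge0 (M : finite_metric R) (x y : M) : 0 <= fm_dist x y.
Proof.
have := fm_dist_triangle y x x; rewrite fm_distxx (fm_dist_sym y x).
by rewrite -mulr2n pmulrn_lge0.
Qed.

Let distxx x : wedge_dist x x = 0.
Proof.
by elim/wedge_ind: x => // n x; rewrite wedge_dist_piece fm_distxx mulr0.
Qed.

Let dist_eq0 x y : wedge_dist x y = 0 -> x = y.
Proof.
elim/wedge_ind: x => [|n x]; elim/wedge_ind: y => [//|m y].
- by move=> /eqP; rewrite gt_eqF// radius_gt0.
- by move=> /eqP; rewrite gt_eqF// radius_gt0.
have [nm|nm] := eqVneq n m; last first.
  by rewrite wedge_dist_pieces// => /eqP; rewrite gt_eqF// addr_gt0 ?radius_gt0.
subst m; rewrite wedge_dist_piece => /eqP; rewrite mulf_eq0 gt_eqF ?radius_gt0//=.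
have [->//|xy] := eqVneq x y; have [e e0 /(_ _ _ xy) exy] := fm_dist_sep (P n).
by rewrite gt_eqF// (lt_le_trans e0).
Qed.

Let dist_sym x y : wedge_dist x y = wedge_dist y x.
Proof.
elim/wedge_ind: x => [|n x]; elim/wedge_ind: y => [//|m y] //.
have [nm|nm] := eqVneq n m; last first.
  by rewrite wedge_dist_pieces// [RHS]wedge_dist_pieces ?[m == n]eq_sym// addrC.
by subst m; rewrite !wedge_dist_piece fm_dist_sym.
Qed.

Let dist_piece_le n (x y : P n) : radius n * fm_dist x y <= radius n.
Proof. by rewrite ler_piMr// fm_dist_le1. Qed.

Let dist_piece_ge0 n (x y : P n) : 0 <= radius n * fm_dist x y.
Proof. by rewrite mulr_ge0// fm_dist_ge0. Qed.

Let dist_triangle y x z : wedge_dist x z <= wedge_dist x y + wedge_dist y z.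
Proof.
have r0 := radius_ge0.
elim/wedge_ind: x => [|n x]; elim/wedge_ind: y => [|m y];
  elim/wedge_ind: z => [|k z] //; rewrite ?distxx ?addr0 ?add0r//.
- by rewrite addr_ge0//=.
- have [mk|mk] := eqVneq m k; last by rewrite wedge_dist_pieces//= addrA; have := r0 m; lra.
  by subst k; rewrite wedge_dist_piece/= lerDl.
- have [nk|nk] := eqVneq n k; last by rewrite wedge_dist_pieces.
  by subst k; rewrite wedge_dist_piece (le_trans (dist_piece_le _ _))//= lerDl.
- have [nm|nm] := eqVneq n m; last by rewrite wedge_dist_pieces//=; have := r0 m; lra.
  by subst m; rewrite wedge_dist_piece/= lerDr.
have [nm|nm] := eqVneq n m; have [mk|mk] := eqVneq m k.
- subst m k; rewrite !wedge_dist_piece -mulrDr ler_wpM2l//.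
  exact: fm_dist_triangle.
- by subst m; rewrite wedge_dist_piece !wedge_dist_pieces// lerDr.
- by subst k; rewrite wedge_dist_piece !wedge_dist_pieces// lerDl.
rewrite [X in _ <= X + _]wedge_dist_pieces// [X in _ <= _ + X]wedge_dist_pieces//.
have [nk|nk] := eqVneq n k; last by rewrite wedge_dist_pieces//; have := r0 m; lra.
subst k; rewrite wedge_dist_piece; have := dist_piece_le x z.
by have := r0 m; have := r0 n; lra.
Qed.

HB.instance Definition _ := isMetric.Build R (wedge P)
  distxx dist_eq0 dist_sym dist_triangle.

Lemma mdist_wedgeE (x y : wedge P) : mdist x y = wedge_dist x y. Proof. by []. Qed.

Lemma wedge_isolated n (x : P n) : exists2 e : R, 0 < e &
  forall y, wedge_dist (piece x) y < e -> y = piece x.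
Proof.
have [e e0 xe] := fm_dist_sep (P n).
(* [e] separates [x] from the rest of its piece, and [1] from everything outside it. *)
exists (radius n * Num.min e 1); first by rewrite mulr_gt0 ?radius_gt0// lt_min e0/=.
have ler : radius n * Num.min e 1 <= radius n by rewrite ler_piMr// ge_min lexx orbT.
elim/wedge_ind => [|m y].
  by move=> /lt_le_trans /(_ ler); rewrite ltxx.
have [nm|nm] := eqVneq n m; last first.
  by rewrite wedge_dist_pieces// => /lt_le_trans /(_ ler); rewrite ltNge lerDl radius_ge0.
subst m; rewrite wedge_dist_piece ltr_pM2l ?radius_gt0// lt_min => /andP[xye _].
have [->//|xy] := eqVneq x y.
by have := xe _ _ xy; rewrite leNgt xye.
Qed.

Lemma wedge_open (A : set (wedge P)) : ~ A None -> open A.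
Proof.
move=> nA; rewrite openE => x; elim/wedge_ind: x => // n x Ax.
have [e e0 xe] := wedge_isolated x; rewrite /interior -nbhs_ballE.
by exists e => // y; rewrite ballEmdist/= mdist_wedgeE => /xe ->.
Qed.

Lemma wedge_closed (A : set (wedge P)) : A None -> closed A.
Proof. by move=> nA; rewrite -openC; apply: wedge_open; exact. Qed.

Lemma wedge_finite (e : R) : 0 < e ->
  finite_set [set x : wedge P | e <= mdist (None : wedge P) x].
Proof.
move=> e0.
have [N Ne] : exists N : nat, forall n, (N <= n)%N -> radius n < e.
  exists (Num.truncn e^-1) => n Nn.
  rewrite /radius -[ltRHS]invrK ltf_pV2 ?posrE ?invr_gt0//.
  apply: (lt_le_trans (truncnS_gt _)) => //.
  by rewrite ler_nat.
apply: (@sub_finite_set _ _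
  (\bigcup_(n in `I_N) range (fun x : P n => piece x))).
  elim/wedge_ind => [/=|n x /= ex]; first by rewrite mdistxx leNgt e0.
  exists n => /=; last by exists x.
  by rewrite ltnNge; apply/negP => /Ne; rewrite ltNge ex.
by apply: bigcup_finite; [exact: finite_II|move=> n _; exact/finite_image].
Qed.

(** A filter that does not cluster at [None] contains a set missing a ball about [None]; such a set
    is finite. *)
Lemma wedge_compact : compact [set: wedge P].
Proof.
move=> F FF _; have [clN|] := pselect (cluster F (None : wedge P)).
  by exists None.
move=> /existsNP[A /existsNP[U /not_implyP[FA /not_implyP[NU AU]]]].
have [e /= e0 eU] : nbhs_ball (None : wedge P) U by rewrite nbhs_ballE.
have Afin : finite_set A.
  apply: (sub_finite_set _ (wedge_finite e0)) => x Ax /=.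
  rewrite leNgt; apply/negP => xe; apply: AU; exists x; split=> //.
  by apply: eU; rewrite ballEmdist.
have [x [Ax clx]] := finite_compact Afin FF FA.
by exists x.
Qed.

(** Balls about [None] are closed because they contain [None]; all other points are isolated. *)
Lemma wedge_clopen_base : has_clopen_base (wedge P).
Proof.
exists clopen => //; split=> [A []//|x U].
rewrite -nbhs_ballE => -[e /= e0 eU].
elim/wedge_ind: x eU => [|n x] eU.
  exists (ball (None : wedge P) e); last exact: eU.
  split; last exact: ballxx.
  split; last by apply: wedge_closed; exact: ballxx.
  rewrite openE => x; rewrite ballEmdist /= => xe.
  rewrite /interior -nbhs_ballE; exists (e - mdist (None : wedge P) x) => /=.
    by rewrite subr_gt0.
  move=> y; rewrite !ballEmdist /= ltrBrDl; apply: le_lt_trans.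
  exact: metric_triangle.
exists [set piece x]; last by move=> y ->; apply: eU; exact: ballxx.
split=> //; split; first exact: wedge_open.
apply: accessible_closed_set1; apply: hausdorff_accessible.
exact: metric_hausdorff.
Qed.

End wedge.

(** * From pseudometrics to Lipschitz functions *)

Section extension_operator_theory.
Context {R : realType} {X : metricType R} {A : set X}.
Context {u : PMLip A -> PMLip X} (uP : is_lip_extension_operator u).

Lemma ext_op_bound : exists2 K : R, 0 <= K &
  forall (rho : PMLip A) (C : R), 0 < C -> (forall x y, rho x y <= C * mdist x y) ->
    forall x y, u rho x y <= K * C * mdist x y.
Proof.
have [uD uZ ue ufin] := uP.
exists `|fine (ext_op_norm u)| => // rho C C0 rhoC x y.
have C0' : 0 <= C^-1 by rewrite invr_ge0 ltW.
have normle (sigma : PMLip A) : (forall x y, sigma x y <= mdist x y) ->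
    lip_norm sigma <= 1.
  move=> sigma1; rewrite /lip_norm; set E := (X in sup X).
  have [->|/set0P E0] := eqVneq E set0; first by rewrite sup0.
  apply: ge_sup => // _ [a [b [/eqP ab ->]]].
  by rewrite ler_pdivrMr ?mdist_gt0// mul1r.
have lenorm (sigma : PMLip X) a b : sigma a b <= lip_norm sigma * mdist a b.
  have [_ sxx _ _] := pmlip_pseudometric sigma.
  have [->|ab] := eqVneq a b; first by rewrite sxx mdistxx mulr0.
  rewrite -ler_pdivrMr ?mdist_gt0//; apply: sup_upper_bound; last first.
    by exists a, b; split=> //; exact/eqP.
  split; first by exists (sigma a b / mdist a b), a, b; split=> //; exact/eqP.
  have [D D0 sD] := pmlip_lip sigma; exists D => _ [c [d [/eqP cd ->]]].
  by rewrite ler_pdivrMr ?mdist_gt0.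
pose sigma := pmlip_scale C0' rho.
have sigma1 : lip_norm sigma <= 1.
  by apply: normle => a b; rewrite /= mulrC ler_pdivrMr// mulrC.
have usigma : lip_norm (u sigma) <= `|fine (ext_op_norm u)|.
  apply: le_trans (ler_norm _); rewrite -lee_fin fineK//.
  by apply: ereal_sup_ubound; exists sigma.
have : u sigma x y <= `|fine (ext_op_norm u)| * mdist x y.
  by apply: (le_trans (lenorm _ _ _)); rewrite ler_wpM2r// mdist_ge0.
by rewrite /sigma uZ /= mulrC ler_pdivrMr// mulrAC.
Qed.

Section linear_relations.
Context {J : finType} (rho : J -> PMLip A) (rho0 : PMLip A).

Lemma ext_op_comb (c : J -> R) : (forall j, 0 <= c j) ->
  exists sigma : PMLip A,
    (forall x y, sigma x y = \sum_j c j * rho j x y) /\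
    (forall x y, u sigma x y = \sum_j c j * u (rho j) x y).
Proof.
have [uD uZ _ _] := uP => c0; elim: (index_enum J) => [|j s [sigma [sE uE]]].
  exists (pmlip_scale (lexx 0) rho0).
  by split=> x y; rewrite ?uZ big_nil /= mul0r.
exists (pmlip_add (pmlip_scale (c0 j) (rho j)) sigma).
by split=> x y; rewrite ?uD ?uZ big_cons /= -?sE -?uE.
Qed.

(** [u] is linear only on a cone, so the negative terms are moved across: the relation becomes an
    equality of two nonnegative combinations, to which [u] applies. *)
Lemma ext_op_rel (c : J -> R) :
  (forall x y, \sum_j c j * (rho j x y - rho0 x y) = 0) ->
  forall x y, \sum_j c j * (u (rho j) x y - u rho0 x y) = 0.
Proof.
have [uD uZ _ _] := uP => crho x y.
pose p j := Num.max (c j) 0; pose n j := Num.max (- c j) 0.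
have cE j : c j = p j - n j.
  have [cj|/ltW cj] := leP 0 (c j).
    have cj' : - c j <= 0 by rewrite oppr_le0.
    by rewrite /p /n (max_l cj) (max_r cj') subr0.
  have cj' : 0 <= - c j by rewrite oppr_ge0.
  by rewrite /p /n (max_r cj) (max_l cj') opprK add0r.
have p0 j : 0 <= p j by rewrite le_max lexx orbT.
have n0 j : 0 <= n j by rewrite le_max lexx orbT.
have [sp [spE uspE]] := ext_op_comb p0; have [sn [snE usnE]] := ext_op_comb n0.
have P0 : 0 <= \sum_j p j by rewrite sumr_ge0.
have N0 : 0 <= \sum_j n j by rewrite sumr_ge0.
have expand (F : J -> R) (F0 : R) : \sum_j c j * (F j - F0) =
    (\sum_j p j * F j + (\sum_j n j) * F0) - (\sum_j n j * F j + (\sum_j p j) * F0).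
  rewrite !mulr_suml -!big_split/= -sumrB; apply: eq_bigr => j _.
  by rewrite cE; ring.
have balance : pmlip_add sp (pmlip_scale N0 rho0) = pmlip_add sn (pmlip_scale P0 rho0).
  apply: pmlip_ext => a b /=; rewrite spE snE; apply/eqP.
  by rewrite -subr_eq0 -expand crho.
have := congr1 (fun s => u s x y) balance; rewrite !uD !uZ /= uspE usnE.
by move/eqP; rewrite -subr_eq0 -expand => /eqP.
Qed.

End linear_relations.
End extension_operator_theory.

(** Crossing the boundary of [lv] costs an extra [g]. In the critical case of two points inside and
    one outside, a path can save only [g x - g y], which the distance [d x y] pays for. *)
Lemma bump_pseudometric (R : realType) (T : Type) (d : T -> T -> R)
    (lv : T -> bool) (g : T -> R) :
  is_pseudometric d -> (forall x, 0 <= g x) -> (forall x, ~~ lv x -> g x = 0) ->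
  (forall x y z, lv x -> lv y -> ~~ lv z -> d x z = d y z) ->
  (forall x y, lv x -> lv y -> g x - g y <= d x y) ->
  is_pseudometric (fun x y => d x y + (lv x (+) lv y)%:R * (g x + g y)).
Proof.
move=> [d0 dxx dC dD] g0 gout dlv glip; split.
- by move=> x y; rewrite addr_ge0// mulr_ge0// addr_ge0.
- by move=> x; rewrite dxx addbb mul0r addr0.
- by move=> x y; rewrite dC addbC (addrC (g x)).
move=> x y z; have := dD x y z; have gx := g0 x; have gy := g0 y; have gz := g0 z.
case lx: (lv x); case ly: (lv y); case lz: (lv z) => /=; rewrite ?mul0r ?mul1r; try lra.
- have := glip _ _ lx ly; rewrite (gout z) ?lz// (dlv x y z)// ?lz//; lra.
- by rewrite (gout z) ?lz//; lra.
- have := glip _ _ lz ly; rewrite (gout x) ?lx// (dC x z) (dC x y).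
  by rewrite (dlv z y x) ?lx// (dC z y); lra.
- by rewrite (gout x) ?lx//; lra.
Qed.

(* The last clause stands for the linearity of [f |-> h]. *)
Definition extends_families (R : realType) (M : finite_metric R) (S : set M)
    (K : R) :=
  forall (J : finType) (f : J -> M -> R),
    (forall j x, S x -> `|f j x| <= 2^-1) ->
    (forall j x y, S x -> S y -> `|f j x - f j y| <= fm_dist x y) ->
    exists h : J -> M -> R,
      [/\ forall j x y, `|h j x - h j y| <= K * fm_dist x y,
          forall j x, S x -> h j x = f j x &
          forall c : J -> R, (forall x, S x -> \sum_j c j * f j x = 0) ->
            forall x, \sum_j c j * h j x = 0].

Section wedge_extension.
Context {R : realType} (P : nat -> finite_metric R) (S : forall n, set (P n)).

Definition wedge_sub : set (wedge P) :=
  [set x | if x is Some p then S (tagged p) else True].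

Definition in_piece (n : nat) (x : wedge P) : bool :=
  if x is Some p then tag p == n else false.

Lemma in_pieceP n x : in_piece n x -> exists y : P n, x = piece y.
Proof. by case: x => //= -[m x] /= /eqP mn; subst m; exists x. Qed.

Definition lift_piece n (f : P n -> R) (x : wedge P) : R :=
  if x is Some p then untag 0 f p else 0.

Lemma lift_piece_in n (f : P n -> R) (x : P n) : lift_piece f (piece x) = f x.
Proof.
by rewrite /lift_piece /= /untag; case: eqP => // e; rewrite (eq_irrelevance e erefl).
Qed.

Lemma lift_piece_out n (f : P n -> R) x : ~~ in_piece n x -> lift_piece f x = 0.
Proof. by case: x => //= p; rewrite /untag; case: eqP. Qed.

Section bump.
Context (n : nat) (f : P n -> R).
Hypothesis f01 : forall x, S x -> 0 <= f x <= 1.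
Hypothesis f_lip : forall x y, S x -> S y -> `|f x - f y| <= fm_dist x y.

Notation lv := (in_piece n).
Notation g := (lift_piece (fun y => radius n * f y)).

Lemma bump_exists : exists rho : PMLip wedge_sub,
  [/\ forall x y, rho x y <= 2 * mdist x y,
      forall (x0 x : wedge_sub) (y : P n), \val x0 = None -> \val x = piece y ->
        rho x0 x = radius n * (1 + f y) &
      forall x y, rho x y = mdist x y +
        (lv (\val x) (+) lv (\val y))%:R * (g (\val x) + g (\val y)) ].
Proof.
have S_piece y : wedge_sub (piece y) -> S y by [].
have r0 := @radius_gt0 R n. have rn0 := ltW r0.
pose rho (x y : wedge_sub) : R := mdist x y +
  (lv (\val x) (+) lv (\val y))%:R * (g (\val x) + g (\val y)).
have gb (x : wedge_sub) : 0 <= g (\val x) <= radius n.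
  case lx : (lv (\val x)); last by rewrite lift_piece_out ?lx// lexx ltW.
  have /in_pieceP[y xy] := lx; rewrite xy lift_piece_in.
  have /f01/andP[f0 f1] : S y by apply: S_piece; rewrite -xy; exact: set_valP.
  by rewrite mulr_ge0//= ler_piMr.
(* Leaving the piece costs at least [radius n], the maximum of [g]; hence the Lipschitz constant
   2. *)
have out_ge x y : lv x -> ~~ lv y -> radius n <= mdist x y.
  move=> /in_pieceP[{}x ->]; elim/(@wedge_ind R P): y => [//|m y] /= mn.
  by rewrite mdist_wedgeE wedge_dist_pieces 1?eq_sym// lerDl ltW// radius_gt0.
have rhoP : is_pseudometric rho.
  apply: bump_pseudometric.
  - split=> *; [exact: mdist_ge0|exact: mdistxx|exact: metric_sym|exact: metric_triangle].
  - by move=> x; have /andP[] := gb x.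
  - by move=> x; exact: lift_piece_out.
  - move=> x y z /in_pieceP[x' xx'] /in_pieceP[y' yy']; rewrite !mdist_set_typeE xx' yy'.
    elim/(@wedge_ind R P): (\val z) => // m z' /= mn.
    by rewrite !mdist_wedgeE !wedge_dist_pieces// eq_sym.
  - move=> x y /in_pieceP[x' xx'] /in_pieceP[y' yy'].
    rewrite mdist_set_typeE xx' yy' !lift_piece_in mdist_wedgeE wedge_dist_piece -mulrBr.
    rewrite ler_wpM2l// (le_trans (ler_norm _))// f_lip//; apply: S_piece.
      by rewrite -xx'; exact: set_valP.
    by rewrite -yy'; exact: set_valP.
have rho2 x y : rho x y <= 2 * mdist x y.
  have /andP[gx0 gx1] := gb x; have /andP[gy0 gy1] := gb y.
  have dxy := mdist_ge0 x y.
  rewrite /rho; case lx : (lv (\val x)); case ly : (lv (\val y)) => /=;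
    rewrite ?mul0r ?mul1r; try lra.
  - rewrite (@lift_piece_out n _ (\val y)) ?ly//.
    have := out_ge (\val x) (\val y); rewrite lx ly -mdist_set_typeE => /(_ isT isT).
    by lra.
  - rewrite (@lift_piece_out n _ (\val x)) ?lx//.
    have := out_ge (\val y) (\val x); rewrite lx ly metric_sym -mdist_set_typeE.
    by move=> /(_ isT isT); lra.
have rholip : is_lip rho by exists 2.
exists (MkPMLip rhoP rholip); split=> // x0 x y xn xy.
rewrite /= /rho mdist_set_typeE xn xy lift_piece_in /= eqxx /= mul1r add0r.
by rewrite mdist_wedgeE /= mulrDr mulr1.
Qed.

End bump.

Lemma lipschitz_extension_family (u : PMLip wedge_sub -> PMLip (wedge P)) :
  is_lip_extension_operator u ->
  exists2 K : R, 0 <= K & forall n, extends_families (@S n) K.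
Proof.
move=> uP; have [uD uZ ue ufin] := uP; have [K K0 uK] := ext_op_bound uP.
exists (4 * K); first by rewrite mulr_ge0.
move=> n J f f2 flip; have r0 := @radius_gt0 R n.
(* The shift makes [f j] nonnegative. The bump [rho0] of the constant [2^-1] is subtracted later to
   remove both the shift and the underlying distance, so that [h] depends linearly on [f]. *)
have f01 j x : S x -> 0 <= f j x + 2^-1 <= 1.
  by move=> Sx; have := f2 j x Sx; rewrite ler_norml; lra.
have flip' j x y : S x -> S y -> `|f j x + 2^-1 - (f j y + 2^-1)| <= fm_dist x y.
  by move=> Sx Sy; rewrite opprD addrACA subrr addr0 flip.
have [rho rhoP] := choice (fun j => bump_exists (f01 j) (flip' j)).
have [||rho0 [rho0_le rho0_piece rho0E]] := @bump_exists n (fun=> 2^-1).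
- by move=> x _; lra.
- by move=> x y _ _; rewrite subrr normr0 fm_dist_ge0.
pose o : wedge P := None.
have So : o \in wedge_sub by rewrite inE.
pose h j (x : P n) := (u (rho j) o (piece x) - u rho0 o (piece x)) / radius n.
exists h; split.
- move=> j x y; rewrite /h -mulrBl normrM [`|(radius n)^-1|]gtr0_norm ?invr_gt0//.
  rewrite ler_pdivrMr//.
  have lip (sigma : PMLip wedge_sub) : (forall x y, sigma x y <= 2 * mdist x y) ->
      `|u sigma o (piece x) - u sigma o (piece y)| <= K * 2 * (radius n * fm_dist x y).
    move=> /(uK _ _ (ltr0Sn _ 1)) /(_ (piece x) (piece y)).
    rewrite mdist_wedgeE wedge_dist_piece; apply: le_trans.
    have [_ _ sC sD] := pmlip_pseudometric (u sigma).
    rewrite ler_norml; have := sD o (piece x) (piece y).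
    by have := sD o (piece y) (piece x); rewrite (sC (piece y)); lra.
  have [rhoj_le _ _] := rhoP j; have := lip _ rhoj_le; have := lip _ rho0_le.
  rewrite !ler_norml.
  rewrite (_ : 4 * K * fm_dist x y * radius n =
    K * 2 * (radius n * fm_dist x y) + K * 2 * (radius n * fm_dist x y)); last by ring.
  by lra.
- move=> j x Sx; have Spx : piece x \in wedge_sub by rewrite inE.
  have [_ rhoj_piece _] := rhoP j.
  have uo (sigma : PMLip wedge_sub) : u sigma o (piece x) = sigma (SigSub So) (SigSub Spx).
    by rewrite -ue.
  rewrite /h !uo (rhoj_piece _ _ x)// (rho0_piece _ _ x)// -mulrBr mulrAC.
  by rewrite divff ?gt_eqF// mul1r; ring.
move=> c cf x; rewrite /h; under eq_bigr => j _ do rewrite mulrA.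
rewrite -mulr_suml (ext_op_rel uP) ?mul0r// => {}x y.
have gsum (z : wedge_sub) : \sum_j c j *
    (lift_piece (fun y => radius n * (f j y + 2^-1)) (\val z) -
     lift_piece (fun y : P n => radius n * 2^-1) (\val z)) = 0.
  case nz : (in_piece n (\val z)); last first.
    by rewrite big1// => j _; rewrite !lift_piece_out ?nz// subrr mulr0.
  have /in_pieceP[y' zy] := nz.
  under eq_bigr => j _ do rewrite zy !lift_piece_in -mulrBr addrK mulrCA.
  rewrite -mulr_sumr cf ?mulr0//.
  by have := set_valP z; rewrite zy.
under eq_bigr => j _.
  have [_ _ ->] := rhoP j; rewrite rho0E opprD addrACA subrr add0r -mulrBr.
  rewrite opprD addrACA mulrCA mulrDr.
  over.
by rewrite -mulr_sumr big_split/= !gsum addr0 mulr0.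
Qed.

End wedge_extension.

(** * Lattice boxes *)

Section box_points.
Context (I : finType) (B : nat).
Notation pt := {ffun I -> int}.
Notation box := {ffun I -> 'I_(B.*2.+1)}.

Definition box_pt (x : box) : pt := [ffun s => (x s : nat)%:Z - B%:Z].

Let box_ptE (x : box) s : box_pt x s = (x s : nat)%:Z - B%:Z :> int.
Proof. by rewrite ffunE. Qed.

Lemma box_ptBE (x y : box) s :
  (box_pt x - box_pt y) s = (x s : nat)%:Z - (y s : nat)%:Z :> int.
Proof. by rewrite !ffunE /=; lia. Qed.

Lemma l1norm_box (x : box) : (l1norm (box_pt x) <= #|I| * B)%N.
Proof.
rewrite /l1norm -sum_nat_const leq_sum// => s _; rewrite box_ptE.
by have := ltn_ord (x s); lia.
Qed.

Let clampn (i : int) : nat := if (i + B%:Z)%R is Posz m then minn m B.*2 else 0%N.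

Let clampn_le i : (clampn i < B.*2.+1)%N.
Proof. by rewrite /clampn; case: (i + _) => m; lia. Qed.

(** The coordinatewise retraction of the lattice onto the box; composition with it extends functions
    to the lattice without increasing their Lipschitz constant. *)
Definition clamp (z : pt) : box := [ffun s => Ordinal (clampn_le (z s))].

Lemma clamp_lipschitz (z z' : pt) :
  (l1norm (box_pt (clamp z) - box_pt (clamp z'))%R <= l1norm (z - z')%R)%N.
Proof.
apply: leq_sum => s _; rewrite box_ptBE !ffunE /= /clampn.
by case E : (z s + _) => [m|m]; case E' : (z' s + _) => [m'|m']; lia.
Qed.

Lemma box_ptK (z : pt) : (l1norm z <= B)%N -> box_pt (clamp z) = z.
Proof.
move=> zB; apply/ffunP => s; rewrite box_ptE ffunE /= /clampn.
have : (`|z s| <= B)%N by rewrite (leq_trans _ zB)// /l1norm (bigD1 s)//= leq_addr.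
by case E : (z s + _) => [m|m]; lia.
Qed.

End box_points.

Section box_metric.
Context {R : realType} (I : finType) (B : nat).
Notation box := {ffun I -> 'I_(B.*2.+1)}.

(** A bound for the l1 diameter of the box, with a successor to keep it positive. *)
Definition box_scale : nat := (2 * (#|I| * B)).+1.

Definition box_dist (x y : box) : R :=
  (l1norm (box_pt x - box_pt y))%:R / box_scale%:R.

Let scale_gt0 : 0 < box_scale%:R :> R. Proof. by rewrite ltr0n. Qed.

Let box_distxx x : box_dist x x = 0.
Proof. by rewrite /box_dist subrr l1norm0 mul0r. Qed.

Let box_dist_sep : exists2 e : R, 0 < e & forall x y, x != y -> e <= box_dist x y.
Proof.
exists box_scale%:R^-1; first by rewrite invr_gt0.
move=> x y xy; rewrite -[leLHS]mul1r ler_pM2r ?invr_gt0// ler1n lt0n.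
apply: contra_neq xy => xy0; apply/ffunP => s; apply/val_inj => /=.
have : (absz ((box_pt x - box_pt y)%R s) <= 0)%N.
  by rewrite -xy0 /l1norm (bigD1 s)//= leq_addr.
by rewrite box_ptBE; lia.
Qed.

Let box_dist_sym x y : box_dist x y = box_dist y x.
Proof. by rewrite /box_dist -l1normN opprB. Qed.

Let box_dist_triangle y x z : box_dist x z <= box_dist x y + box_dist y z.
Proof.
rewrite /box_dist -mulrDl ler_pM2r ?invr_gt0// -natrD ler_nat.
by rewrite (leq_trans _ (l1normD _ _))// addrA subrK.
Qed.

Let box_dist_le1 x y : box_dist x y <= 1.
Proof.
rewrite /box_dist ler_pdivrMr// mul1r ler_nat (leq_trans (l1normD _ _))//.
rewrite l1normN (leq_trans (leq_add (l1norm_box x) (l1norm_box y)))//.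
by rewrite addnn -mul2n /box_scale.
Qed.

Definition box_metric : finite_metric R :=
  FiniteMetric box_distxx box_dist_sep box_dist_sym box_dist_triangle box_dist_le1.

End box_metric.

Lemma box_extension_bound (R : realType) (k : nat) :
  exists MS : {M : finite_metric R & set M}, forall K : R, 0 <= K ->
    extends_families (projT2 MS) K -> (4 / 3) ^+ k <= 3 * K.
Proof.
have [I [q [w [cI qP]]]] := spread_proj_pow k.
have I0 : (0 < #|I|)%N by rewrite cI expn_gt0.
have [B trB] := @trace_le_lipschitz R I q w _ _ qP I0.
have [w0 _ _ qE] := qP.
pose S : set (@box_metric R I B) := [set x | fixed_by q w (box_pt x)].
exists (existT (fun M : finite_metric R => set M) _ S) => K K0 /= extK.
set theta : R := (2 ^ k)%:R; have theta0 : 0 < theta by rewrite ltr0n expn_gt0.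
set D : R := (box_scale I B)%:R; have D0 : 0 < D by rewrite ltr0n.
have coord_le (a : {ffun I -> int}) s : fixed_by q w a ->
    `|theta * (a s)%:~R| <= (l1norm a)%:R.
  move=> /qE /(_ s); rewrite -(ler_int R) => ha.
  rewrite normrM gtr0_norm// -intr_norm; move: ha.
  rewrite intrM -pmulrn => /le_trans; apply.
  rewrite /l1norm raddf_sum natr_sum; apply: ler_sum => t _.
  by rewrite pmulrn abszE.
have fixedB (a b : {ffun I -> int}) :
    fixed_by q w a -> fixed_by q w b -> fixed_by q w (a - b).
  move=> aE bE s; rewrite !ffunE mulrBr -aE -bE -sumrB.
  by apply: eq_bigr => t _; rewrite !ffunE mulrBr.
(* Flatness of the range makes these scaled coordinates 1-Lipschitz on [S]; they are at most [2^-1]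
   there because [D] exceeds twice the norm of any box point. *)
pose f s (x : @box_metric R I B) : R := theta * (box_pt x s)%:~R / D.
have [s x Sx|s x y Sx Sy|h [hlip hf hrel]] := extK I f.
- rewrite normrM [`|D^-1|]gtr0_norm ?invr_gt0// ler_pdivrMr//.
  rewrite (le_trans (coord_le _ _ Sx))// mulrC ler_pdivlMr// -natrM ler_nat mulnC.
  by rewrite /box_scale leqW// leq_mul2l l1norm_box.
- rewrite /f -mulrBl -mulrBr -intrB normrM [`|D^-1|]gtr0_norm ?invr_gt0//.
  rewrite /fm_dist /= /box_dist ler_pM2r ?invr_gt0//.
  have := coord_le _ s (fixedB _ _ Sx Sy); rewrite !ffunE.
  by [].
(* Undoing the scaling restores the coordinates on [E] near the origin, with Lipschitz constant
   [K / theta]. *)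
pose H s z : R := h s (clamp B z) * (D / theta).
have Dt0 : 0 < D / theta by rewrite divr_gt0.
(* The rank is also [2 ^ k], so [theta] stands on the left for [tau]. *)
suff : theta <= 3 * (K / theta) * #|I|%:R.
  have -> : 3 * (K / theta) * #|I|%:R = 3 * K * 3 ^+ k / theta.
    by rewrite cI natrX; ring.
  rewrite ler_pdivlMr// /theta -natrM -expnMn natrX.
  by rewrite expr_div_n ler_pdivrMr ?exprn_gt0.
apply: (trB _ H).
- by rewrite divr_ge0// ltW.
- move=> t x y; rewrite /H -mulrBl normrM (gtr0_norm Dt0).
  rewrite -ler_pdivlMr// (le_trans (hlip _ _ _))//= /box_dist -/D.
  have -> : K / theta * (l1norm (x - y))%:R / (D / theta) = K * ((l1norm (x - y))%:R / D).
    by field; rewrite !gt_eqF.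
  by rewrite ler_wpM2l// ler_pM2r ?invr_gt0// ler_nat clamp_lipschitz.
- move=> s z; rewrite /H; under eq_bigr => t _ do rewrite (mulrA _%:~R).
  rewrite -mulr_suml [RHS]mulrA; congr (_ * _); apply/eqP.
  rewrite -subr_eq0 -(sum_subdelta _ _ (h^~ _)); apply/eqP; apply: hrel => x Sx.
  rewrite (sum_subdelta _ _ (f^~ x)).
  under eq_bigr => t _ do rewrite /f mulrA mulrCA.
  rewrite -mulr_suml -mulr_sumr.
  have -> : \sum_t (q s t)%:~R * (box_pt x t)%:~R = w%:R * (box_pt x s)%:~R :> R.
    rewrite pmulrn -intrM -Sx raddf_sum/=.
    by apply: eq_bigr => t _; rewrite intrM.
  by rewrite /f; ring.
- move=> t a aE aB; have aK := box_ptK aB.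
  rewrite /H hf; last by rewrite /S /= aK.
  by rewrite /f aK; field; rewrite !gt_eqF.
Qed.

Theorem theorem4p1 (R : realType) :
  exists (X : metricType R) (A : set X),
    [/\ compact [set: X],
        has_clopen_base X,
        closed A &
        ~ exists u : PMLip A -> PMLip X, is_lip_extension_operator u].
Proof.
have [MS MSP] := choice (@box_extension_bound R).
pose P n := projT1 (MS n); pose S n : set (P n) := projT2 (MS n).
exists (wedge P), (wedge_sub S); split.
- exact: wedge_compact.
- exact: wedge_clopen_base.
- exact: wedge_closed.
move=> [u /lipschitz_extension_family [K K0 extK]].
have bernoulli k : 1 + k%:R / 3 <= (4 / 3) ^+ k :> R.
  elim: k => [|k IH]; first by rewrite mul0r addr0 expr0.
  rewrite exprS -natr1; have : 0 <= k%:R :> R by [].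
  move: IH; lra.
(* A piece of index [k > 9 * K] suffices, as then [1 + k / 3 > 3 * K]. *)
have := le_trans (bernoulli _) (MSP (Num.truncn (9 * K)).+1 K K0 (extK _)).
by have := truncnS_gt (9 * K); lra.
Qed.
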